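(* Let $\mathcal{C}$ be an additive symmetric monoidal category with finite coproducts and with reflexive coequalizers, the latter being preserved by the tensor product in each variable. Let $Alg$ be the category of commutative algebras in $\mathcal{C}$, suppose that the forgetful functor $Alg\to\mathcal{C}$ has a left adjoint, and let $\mathcal{S}=(S,\eta,\mu)$ be the induced monad (the symmetric algebra monad) on $\mathcal{C}$. Equip each $SC$ with its free commutative algebra structure, and let $d_{SC}:SC\to SC\otimes C$ be the derivation such that $\langle 1_{SC},d_{SC}\rangle: SC\to SC\oplus(SC\otimes C)$ is the unique algebra homomorphism whose composite with $\eta_C:C\to SC$ is $\langle \eta_C,u_C\rangle: C\to SC\oplus (SC\otimes C)$, where $u_C = e\otimes 1_C: C\cong k\otimes C\to SC\otimes C$. Then $(\mathcal{C},S,d)$ is a codifferential category.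
   Context: Composition is written in diagrammatic order: $f;g$ means first $f$, then $g$. Monoidal structures are written as if strict, with unit $k$ and symmetry $c$. An additive symmetric monoidal category is a symmetric monoidal category enriched over commutative monoids (hom-sets have addition and zero, composition is bilinear) whose tensor functor is additive in both variables. In such a category finite coproducts are biproducts, written $\oplus$, with projections $\pi_1,\pi_2$ and pairing $\langle f,g\rangle$. A commutative algebra is a commutative monoid object $(A,m_A,e_A)$; a module is a left module $\bullet_M:A\otimes M\to M$. A derivation $\partial:A\to M$ is a morphism with $m_A;\partial = c;(1\otimes\partial);\bullet_M+(1\otimes\partial);\bullet_M$ and $e_A;\partial=0$. For a commutative algebra $A$ and an $A$-module $M$, $A\oplus M$ is a commutative algebra with multiplication whose first component is $(\pi_1\otimes\pi_1);m_A$, whose second component is $(\pi_1\otimes\pi_2);\bullet_M+c;(\pi_1\otimes\pi_2);\bullet_M$, and with unit $\langle e_A,0\rangle$; derivations $\partial:A\to M$ correspond bijectively to algebra homomorphisms $\langle 1_A,\partial\rangle:A\to A\oplus M$. The object $SC\otimes C$ is the free $SC$-module on $C$, with action $m_{SC}\otimes 1_C$. An algebra modality on a symmetric monoidal category consists of a monad $(T,\mu,\eta)$ and, for each object $C$, morphisms $m:TC\otimes TC\to TC$, $e:k\to TC$ making $TC$ a commutative algebra, such that $m,e$ are natural in $C$ (each $Tf$ is an algebra homomorphism) and each $\mu_C:T^2C\to TC$ is an algebra homomorphism. A codifferential category is an additive symmetric monoidal category with an algebra modality $T$ and a deriving transform, i.e. a transformation $d_{TC}:TC\to TC\otimes C$,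 natural in $C$, such that: (d1) $e;d=0$; (d2) $m;d=(1\otimes d);(m\otimes 1)+(d\otimes 1);c;(m\otimes 1)$, where $c$ here is the symmetry $TC\otimes C\otimes TC\to TC\otimes TC\otimes C$; (d3) $\eta;d=e\otimes 1$; (d4) $\mu;d=d;(\mu\otimes d);(m\otimes 1)$, i.e. $\mu_C;d_{TC}=d_{T^2C};(\mu_C\otimes d_{TC});(m\otimes 1_C)$. *)

(* Defs.v *)
From Stdlib Require Import ProofIrrelevance.
From mathcomp Require Import ssreflect ssrfun.

Set Implicit Arguments.
Unset Strict Implicit.
Unset Printing Implicit Defensive.

Declare Scope cat_scope.
Delimit Scope cat_scope with cat.
Local Open Scope cat_scope.

(* Composition is in diagrammatic order: [f ;; g] is first [f], then [g]. *)
Record category := Category {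
  obj :> Type;
  hom : obj -> obj -> Type;
  idm : forall A, hom A A;
  comp : forall A B D, hom A B -> hom B D -> hom A D;
  compA : forall A B D E (f : hom A B) (g : hom B D) (h : hom D E),
    comp (comp f g) h = comp f (comp g h);
  comp1m : forall A B (f : hom A B), comp (idm A) f = f;
  compm1 : forall A B (f : hom A B), comp f (idm B) = f }.

Arguments hom {c} A B.
Arguments idm {c} A.
Arguments comp {c A B D} f g.
Arguments compA {c A B D E} f g h.
Arguments comp1m {c A B} f.
Arguments compm1 {c A B} f.

Notation "f ;; g" := (comp f g) (at level 45, right associativity) : cat_scope.

Record functor (C D : category) := Functor {
  fobj :> C -> D;
  fmap : forall A B : C, hom A B -> hom (fobj A) (fobj B);
  fmap_id : forall A : C, fmap (idm A) = idm (fobj A);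
  fmap_comp : forall (A B E : C) (f : hom A B) (g : hom B E),
    fmap (f ;; g) = fmap f ;; fmap g }.

Arguments fmap {C D} f0 {A B} f : rename.

Record adjunction (C D : category) (F : functor C D) (U : functor D C) :=
  Adjunction {
  adj_unit : forall X : C, hom X (U (F X));
  adj_counit : forall A : D, hom (F (U A)) A;
  adj_unit_nat : forall (X Y : C) (f : hom X Y),
    f ;; adj_unit Y = adj_unit X ;; fmap U (fmap F f);
  adj_counit_nat : forall (A B : D) (f : hom A B),
    fmap F (fmap U f) ;; adj_counit B = adj_counit A ;; f;
  adj_triangle_l : forall X : C,
    fmap F (adj_unit X) ;; adj_counit (F X) = idm (F X);
  adj_triangle_r : forall A : D,
    adj_unit (U A) ;; fmap U (adj_counit A) = idm (U A) }.

Record monad (C : category) := Monad {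
  mfun :> functor C C;
  eta : forall X : C, hom X (mfun X);
  mu : forall X : C, hom (mfun (mfun X)) (mfun X);
  eta_nat : forall (X Y : C) (f : hom X Y), f ;; eta Y = eta X ;; fmap mfun f;
  mu_nat : forall (X Y : C) (f : hom X Y),
    fmap mfun (fmap mfun f) ;; mu Y = mu X ;; fmap mfun f;
  mu_assoc : forall X : C, fmap mfun (mu X) ;; mu X = mu (mfun X) ;; mu X;
  mu_eta_l : forall X : C, eta (mfun X) ;; mu X = idm (mfun X);
  mu_eta_r : forall X : C, fmap mfun (eta X) ;; mu X = idm (mfun X) }.

Arguments eta {C} m X.
Arguments mu {C} m X.

Definition comp_functor (C D E : category) (F : functor C D) (G : functor D E) :
  functor C E.
Proof.
exists (fun X => G (F X)) (fun A B f => fmap G (fmap F f)).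
- by move=> A; rewrite !fmap_id.
- by move=> A B X f g; rewrite !fmap_comp.
Defined.

Definition adj_monad (C D : category) (F : functor C D) (U : functor D C)
  (adj : adjunction F U) : monad C.
Proof.
exists (comp_functor F U) (adj_unit adj)
       (fun X => fmap U (adj_counit adj (F X))) => /=.
- exact: adj_unit_nat.
- by move=> X Y f; rewrite -!fmap_comp adj_counit_nat.
- by move=> X; rewrite -!fmap_comp adj_counit_nat.
- by move=> X; rewrite adj_triangle_r.
- by move=> X; rewrite -!fmap_comp adj_triangle_l !fmap_id.
Defined.

Definition is_coequalizer (C : category) (A B Q : C) (f g : hom A B)
    (q : hom B Q) : Prop :=
  f ;; q = g ;; q /\
  forall (Z : C) (h : hom B Z), f ;; h = g ;; h -> exists! k : hom Q Z, q ;; k = h.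

Definition is_reflexive_pair (C : category) (A B : C) (f g : hom A B) : Prop :=
  exists s : hom B A, s ;; f = idm B /\ s ;; g = idm B.

Definition has_reflexive_coequalizers (C : category) : Prop :=
  forall (A B : C) (f g : hom A B), is_reflexive_pair f g ->
  exists (Q : C) (q : hom B Q), is_coequalizer f g q.

Record finite_coproducts (C : category) := FiniteCoproducts {
  initial : C;
  from_initial : forall A : C, hom initial A;
  from_initial_uniq : forall (A : C) (f : hom initial A), f = from_initial A;
  cop : C -> C -> C;
  in1 : forall A B : C, hom A (cop A B);
  in2 : forall A B : C, hom B (cop A B);
  copair : forall A B X : C, hom A X -> hom B X -> hom (cop A B) X;
  copair_in1 : forall (A B X : C) (f : hom A X) (g : hom B X),
    in1 A B ;; copair f g = f;
  copair_in2 : forall (A B X : C) (f : hom A X) (g : hom B X),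
    in2 A B ;; copair f g = g;
  copair_uniq : forall (A B X : C) (f : hom A X) (g : hom B X)
    (h : hom (cop A B) X), in1 A B ;; h = f -> in2 A B ;; h = g ->
    h = copair f g }.

Arguments in1 {C} f A B : rename.
Arguments in2 {C} f A B : rename.
Arguments copair {C} f0 {A B X} f g : rename.

Reserved Notation "A ⊗ B" (at level 40, left associativity).
Reserved Notation "f ⊗₁ g" (at level 40, left associativity).

(* Nothing is assumed strict: [alpha], [lam], [rho] are the associator and
   unitors, and formulas usually written as in the strict case are stated below
   with these isomorphisms inserted.  The axioms are Mac Lane's. *)
Record symmetric_monoidal_category := SymmetricMonoidalCategory {
  smc_cat :> category;
  tens : smc_cat -> smc_cat -> smc_cat
    where "A ⊗ B" := (tens A B);
  tensm : forall A B A' B' : smc_cat,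
    hom A A' -> hom B B' -> hom (A ⊗ B) (A' ⊗ B')
    where "f ⊗₁ g" := (tensm f g);
  unit_obj : smc_cat;
  alpha : forall A B D : smc_cat, hom ((A ⊗ B) ⊗ D) (A ⊗ (B ⊗ D));
  alphaV : forall A B D : smc_cat, hom (A ⊗ (B ⊗ D)) ((A ⊗ B) ⊗ D);
  lam : forall A : smc_cat, hom (unit_obj ⊗ A) A;
  lamV : forall A : smc_cat, hom A (unit_obj ⊗ A);
  rho : forall A : smc_cat, hom (A ⊗ unit_obj) A;
  rhoV : forall A : smc_cat, hom A (A ⊗ unit_obj);
  sym : forall A B : smc_cat, hom (A ⊗ B) (B ⊗ A);
  tensm_id : forall A B : smc_cat, idm A ⊗₁ idm B = idm (A ⊗ B);
  tensm_comp : forall (A B D A' B' D' : smc_cat)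
    (f : hom A B) (g : hom B D) (f' : hom A' B') (g' : hom B' D'),
    (f ;; g) ⊗₁ (f' ;; g') = (f ⊗₁ f') ;; (g ⊗₁ g');
  alpha_nat : forall (A B D A' B' D' : smc_cat)
    (f : hom A A') (g : hom B B') (h : hom D D'),
    ((f ⊗₁ g) ⊗₁ h) ;; alpha A' B' D' = alpha A B D ;; (f ⊗₁ (g ⊗₁ h));
  alphaK : forall A B D : smc_cat, alpha A B D ;; alphaV A B D = idm _;
  alphaVK : forall A B D : smc_cat, alphaV A B D ;; alpha A B D = idm _;
  lam_nat : forall (A B : smc_cat) (f : hom A B),
    (idm unit_obj ⊗₁ f) ;; lam B = lam A ;; f;
  lamK : forall A : smc_cat, lam A ;; lamV A = idm _;
  lamVK : forall A : smc_cat, lamV A ;; lam A = idm _;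
  rho_nat : forall (A B : smc_cat) (f : hom A B),
    (f ⊗₁ idm unit_obj) ;; rho B = rho A ;; f;
  rhoK : forall A : smc_cat, rho A ;; rhoV A = idm _;
  rhoVK : forall A : smc_cat, rhoV A ;; rho A = idm _;
  sym_nat : forall (A B A' B' : smc_cat) (f : hom A A') (g : hom B B'),
    (f ⊗₁ g) ;; sym A' B' = sym A B ;; (g ⊗₁ f);
  symK : forall A B : smc_cat, sym A B ;; sym B A = idm _;
  pentagon : forall A B D E : smc_cat,
    (alpha A B D ⊗₁ idm E) ;; alpha A (B ⊗ D) E ;; (idm A ⊗₁ alpha B D E)
    = alpha (A ⊗ B) D E ;; alpha A B (D ⊗ E);
  triangle : forall A B : smc_cat,
    alpha A unit_obj B ;; (idm A ⊗₁ lam B) = rho A ⊗₁ idm B;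
  hexagon : forall A B D : smc_cat,
    alpha A B D ;; sym A (B ⊗ D) ;; alpha B D A
    = (sym A B ⊗₁ idm D) ;; alpha B A D ;; (idm B ⊗₁ sym A D);
  sym_lam : forall A : smc_cat, sym A unit_obj ;; lam A = rho A }.

Arguments tens {s} A B.
Arguments tensm {s A B A' B'} f g.
Arguments unit_obj {s}.
Arguments alpha {s} A B D.
Arguments alphaV {s} A B D.
Arguments lam {s} A.
Arguments lamV {s} A.
Arguments rho {s} A.
Arguments rhoV {s} A.
Arguments sym {s} A B.

Notation "A ⊗ B" := (tens A B) : cat_scope.
Notation "f ⊗₁ g" := (tensm f g) : cat_scope.

Definition tensor_preserves_reflexive_coequalizers
    (C : symmetric_monoidal_category) : Prop :=
  forall (A B Q : C) (f g : hom A B) (q : hom B Q),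
  is_reflexive_pair f g -> is_coequalizer f g q ->
  forall X : C,
  is_coequalizer (f ⊗₁ idm X) (g ⊗₁ idm X) (q ⊗₁ idm X) /\
  is_coequalizer (idm X ⊗₁ f) (idm X ⊗₁ g) (idm X ⊗₁ q).

Record additive_smc := AdditiveSMC {
  asmc_smc :> symmetric_monoidal_category;
  hzero : forall A B : asmc_smc, hom A B;
  hadd : forall A B : asmc_smc, hom A B -> hom A B -> hom A B;
  haddA : forall A B : asmc_smc, associative (@hadd A B);
  haddC : forall A B : asmc_smc, commutative (@hadd A B);
  hadd0 : forall A B : asmc_smc, left_id (hzero A B) (@hadd A B);
  compDl : forall (A B D : asmc_smc) (f g : hom A B) (h : hom B D),
    hadd f g ;; h = hadd (f ;; h) (g ;; h);
  compDr : forall (A B D : asmc_smc) (f : hom A B) (g h : hom B D),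
    f ;; hadd g h = hadd (f ;; g) (f ;; h);
  comp0m : forall (A B D : asmc_smc) (h : hom B D),
    hzero A B ;; h = hzero A D;
  compm0 : forall (A B D : asmc_smc) (f : hom A B),
    f ;; hzero B D = hzero A D;
  tensmDl : forall (A B A' B' : asmc_smc) (f g : hom A A') (h : hom B B'),
    hadd f g ⊗₁ h = hadd (f ⊗₁ h) (g ⊗₁ h);
  tensmDr : forall (A B A' B' : asmc_smc) (f : hom A A') (g h : hom B B'),
    f ⊗₁ hadd g h = hadd (f ⊗₁ g) (f ⊗₁ h);
  tens0m : forall (A B A' B' : asmc_smc) (h : hom B B'),
    hzero A A' ⊗₁ h = hzero (A ⊗ B) (A' ⊗ B');
  tensm0 : forall (A B A' B' : asmc_smc) (f : hom A A'),
    f ⊗₁ hzero B B' = hzero (A ⊗ B) (A' ⊗ B') }.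

Arguments hzero {a} A B.
Arguments hadd {a A B} f g.

Notation "f + g" := (hadd f g) : cat_scope.

(* With zero and addition on homs, coproducts are biproducts: [proj1], [proj2]
   and [pair] are the induced product structure. *)
Definition proj1 (C : additive_smc) (P : finite_coproducts C) (A B : C) :
    hom (cop P A B) A :=
  copair P (idm A) (hzero B A).

Definition proj2 (C : additive_smc) (P : finite_coproducts C) (A B : C) :
    hom (cop P A B) B :=
  copair P (hzero A B) (idm B).

Definition pair (C : additive_smc) (P : finite_coproducts C) (X A B : C)
    (f : hom X A) (g : hom X B) : hom X (cop P A B) :=
  (f ;; in1 P A B) + (g ;; in2 P A B).

Lemma haddm0 (C : additive_smc) (A B : C) (f : hom A B) : f + hzero A B = f.
Proof. by rewrite haddC hadd0. Qed.

Lemma pair_proj1 (C : additive_smc) (P : finite_coproducts C) (X A B : C)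
  (f : hom X A) (g : hom X B) : pair P f g ;; proj1 P A B = f.
Proof.
by rewrite /pair /proj1 compDl !compA copair_in1 copair_in2 compm1 compm0 haddm0.
Qed.

Lemma pair_proj2 (C : additive_smc) (P : finite_coproducts C) (X A B : C)
  (f : hom X A) (g : hom X B) : pair P f g ;; proj2 P A B = g.
Proof.
by rewrite /pair /proj2 compDl !compA copair_in1 copair_in2 compm1 compm0 hadd0.
Qed.

Lemma pair_eta (C : additive_smc) (P : finite_coproducts C) (X A B : C)
  (f : hom X (cop P A B)) : f = pair P (f ;; proj1 P A B) (f ;; proj2 P A B).
Proof.
rewrite /pair !compA -compDr -[LHS]compm1; congr (_ ;; _).
transitivity (copair P (in1 P A B) (in2 P A B)).
  by apply: copair_uniq; rewrite compm1.
symmetry; apply: copair_uniq; rewrite compDr -!compA /proj1 /proj2.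
  by rewrite !copair_in1 comp1m comp0m haddm0.
by rewrite !copair_in2 comp1m comp0m hadd0.
Qed.

Lemma pair_ext (C : additive_smc) (P : finite_coproducts C) (X A B : C)
  (f g : hom X (cop P A B)) :
  f ;; proj1 P A B = g ;; proj1 P A B -> f ;; proj2 P A B = g ;; proj2 P A B ->
  f = g.
Proof. by move=> e1 e2; rewrite (pair_eta f) (pair_eta g) e1 e2. Qed.

Record is_comm_monoid (C : symmetric_monoidal_category) (A : C)
    (m : hom (A ⊗ A) A) (e : hom unit_obj A) : Prop := IsCommMonoid {
  cm_mulA : (m ⊗₁ idm A) ;; m = alpha A A A ;; (idm A ⊗₁ m) ;; m;
  cm_unitl : (e ⊗₁ idm A) ;; m = lam A;
  cm_unitr : (idm A ⊗₁ e) ;; m = rho A;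
  cm_mulC : sym A A ;; m = m }.

Definition is_monoid_hom (C : symmetric_monoidal_category) (A B : C)
    (mA : hom (A ⊗ A) A) (eA : hom unit_obj A)
    (mB : hom (B ⊗ B) B) (eB : hom unit_obj B) (f : hom A B) : Prop :=
  (f ⊗₁ f) ;; mB = mA ;; f /\ eA ;; f = eB.

Record comm_algebra (C : symmetric_monoidal_category) := CommAlgebra {
  alg_obj :> C;
  alg_mul : hom (alg_obj ⊗ alg_obj) alg_obj;
  alg_unit : hom unit_obj alg_obj;
  alg_laws : is_comm_monoid alg_mul alg_unit }.

Arguments alg_mul {C} c.
Arguments alg_unit {C} c.

Definition is_alg_hom (C : symmetric_monoidal_category) (A B : comm_algebra C)
    (f : hom (A : C) (B : C)) : Prop :=
  is_monoid_hom (alg_mul A) (alg_unit A) (alg_mul B) (alg_unit B) f.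

Arguments is_alg_hom {C} A B f.

Lemma alg_hom_id (C : symmetric_monoidal_category) (A : comm_algebra C) :
  is_alg_hom A A (idm (A : C)).
Proof. by split; rewrite ?tensm_id ?comp1m compm1. Qed.

Lemma alg_hom_comp (C : symmetric_monoidal_category) (A B D : comm_algebra C)
  (f : hom (A : C) (B : C)) (g : hom (B : C) (D : C)) :
  is_alg_hom A B f -> is_alg_hom B D g -> is_alg_hom A D (f ;; g).
Proof.
move=> [fM f1] [gM g1]; split; last by rewrite -compA f1 g1.
by rewrite tensm_comp compA gM -compA fM compA.
Qed.

Definition alg_cat (C : symmetric_monoidal_category) : category.
Proof.
exists (comm_algebra C)
  (fun A B : comm_algebra C => {f : hom (A : C) (B : C) | is_alg_hom A B f})
  (fun A : comm_algebra C => exist _ (idm (A : C)) (alg_hom_id A))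
  (fun A B D f g => exist _ (proj1_sig f ;; proj1_sig g)
                      (alg_hom_comp (proj2_sig f) (proj2_sig g))).
- by move=> A B D E f g h; apply: subset_eq_compat; rewrite compA.
- by move=> A B [f hf]; apply: subset_eq_compat; rewrite comp1m.
- by move=> A B [f hf]; apply: subset_eq_compat; rewrite compm1.
Defined.

Definition forget (C : symmetric_monoidal_category) : functor (alg_cat C) C :=
  @Functor (alg_cat C) C (@alg_obj C) (fun A B f => proj1_sig f)
    (fun A => erefl) (fun A B E f g => erefl).


Record amodule (C : symmetric_monoidal_category) (A : comm_algebra C) := AModule {
  mod_obj :> C;
  act : hom ((A : C) ⊗ mod_obj) mod_obj;
  act_mul : (alg_mul A ⊗₁ idm mod_obj) ;; act
    = alpha _ _ _ ;; (idm (A : C) ⊗₁ act) ;; act;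
  act_unit : (alg_unit A ⊗₁ idm mod_obj) ;; act = lam mod_obj }.

Arguments act {C A} a.

Definition is_derivation (C : additive_smc) (A : comm_algebra C)
    (M : amodule A) (D : hom (A : C) (M : C)) : Prop :=
  alg_mul A ;; D
  = (sym A A ;; (idm (A : C) ⊗₁ D) ;; act M) + ((idm (A : C) ⊗₁ D) ;; act M)
  /\ alg_unit A ;; D = hzero unit_obj (M : C).

Section Bifunctor.
Context {C : symmetric_monoidal_category}.
Implicit Types A B D X : C.

Lemma tensm_mul1 A B D X (f : hom A B) (g : hom B D) :
  (f ;; g) ⊗₁ idm X = (f ⊗₁ idm X) ;; (g ⊗₁ idm X).
Proof. by rewrite -tensm_comp comp1m. Qed.

Lemma tensm_1mul A B D X (f : hom A B) (g : hom B D) :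
  idm X ⊗₁ (f ;; g) = (idm X ⊗₁ f) ;; (idm X ⊗₁ g).
Proof. by rewrite -tensm_comp comp1m. Qed.

Lemma unit_tensm_inj A B (f g : hom A B) :
  idm (@unit_obj C) ⊗₁ f = idm unit_obj ⊗₁ g -> f = g.
Proof.
move=> e; rewrite -[f]comp1m -[g]comp1m -lamVK !compA -!lam_nat.
by rewrite e.
Qed.

Lemma alphaV_nat A B D A' B' D' (f : hom A A') (g : hom B B') (h : hom D D') :
  (f ⊗₁ (g ⊗₁ h)) ;; alphaV A' B' D' = alphaV A B D ;; ((f ⊗₁ g) ⊗₁ h).
Proof.
rewrite -[LHS]comp1m -(alphaVK A B D) !compA; congr (_ ;; _).
by rewrite -compA -alpha_nat compA alphaK compm1.
Qed.

Lemma alpha_epi A B D X (f g : hom (A ⊗ (B ⊗ D)) X) :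
  alpha A B D ;; f = alpha A B D ;; g -> f = g.
Proof. by move=> e; rewrite -[f]comp1m -[g]comp1m -alphaVK !compA e. Qed.

Lemma alpha_mono A B D X (f g : hom X ((A ⊗ B) ⊗ D)) :
  f ;; alpha A B D = g ;; alpha A B D -> f = g.
Proof. by move=> e; rewrite -[f]compm1 -[g]compm1 -alphaK -!compA e. Qed.

Lemma alpha_lam A B : alpha unit_obj A B ;; lam (A ⊗ B) = lam A ⊗₁ idm B.
Proof.
apply: unit_tensm_inj; apply: alpha_epi.
have epi X (f g : hom ((unit_obj ⊗ (unit_obj ⊗ A)) ⊗ B) X) :
    (alpha unit_obj unit_obj A ⊗₁ idm B) ;; f
    = (alpha unit_obj unit_obj A ⊗₁ idm B) ;; g -> f = g.
  move=> e; rewrite -[f]comp1m -[g]comp1m -tensm_id -alphaVK tensm_mul1 !compA.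
  by rewrite e.
apply: epi; rewrite tensm_1mul.
transitivity (((rho unit_obj ⊗₁ idm A) ⊗₁ idm B) ;; alpha unit_obj A B).
  rewrite -(compA (alpha _ _ _)) -compA pentagon compA triangle.
  by rewrite -(tensm_id A B) -alpha_nat.
by rewrite -alpha_nat -compA -tensm_mul1 triangle.
Qed.

Lemma sym_alpha A B D :
  sym (A ⊗ B) D ;; alphaV D A B
  = alpha A B D ;; (idm A ⊗₁ sym B D) ;; alphaV A D B ;; (sym A D ⊗₁ idm B).
Proof.
apply: alpha_mono; rewrite !compA alphaVK compm1.
have h : alpha D A B ;; sym D (A ⊗ B)
    = (sym D A ⊗₁ idm B) ;; alpha A D B ;; (idm A ⊗₁ sym D B) ;; alphaV A B D.
  by rewrite -[LHS]compm1 -(alphaK A B D) -!compA (compA (alpha D A B)) hexagon !compA.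
rewrite -[LHS]comp1m -[RHS]compm1 -(symK D (A ⊗ B)) -!compA.
congr (_ ;; _); symmetry.
rewrite !compA h -(compA (sym A D ⊗₁ _)) -tensm_mul1 symK tensm_id comp1m.
rewrite -(compA (alphaV _ _ _)) alphaVK comp1m.
rewrite -(compA (idm A ⊗₁ _)) -tensm_1mul symK tensm_id comp1m.
by rewrite alphaK.
Qed.
Lemma pentagonV A B D E :
  alphaV (A ⊗ B) D E ;; (alpha A B D ⊗₁ idm E)
  = alpha A B (D ⊗ E) ;; (idm A ⊗₁ alphaV B D E) ;; alphaV A (B ⊗ D) E.
Proof.
apply: alpha_epi; rewrite -compA alphaK comp1m.
rewrite -[RHS]compA -pentagon !compA -(compA (idm A ⊗₁ _)) -tensm_1mul alphaK.
by rewrite tensm_id comp1m alphaK compm1.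
Qed.
Lemma assoc_step X Y Z A B D E G V
  (f : hom X A) (g : hom Y B) (h : hom Z D) (u : hom (A ⊗ B) E)
  (v : hom (E ⊗ D) V) (w : hom (B ⊗ D) G) (z : hom (A ⊗ G) V) :
  (u ⊗₁ idm D) ;; v = alpha A B D ;; (idm A ⊗₁ w) ;; z ->
  (((f ⊗₁ g) ;; u) ⊗₁ h) ;; v = alpha X Y Z ;; (f ⊗₁ ((g ⊗₁ h) ;; w)) ;; z.
Proof.
move=> e; rewrite -{1}[h]compm1 tensm_comp compA e -compA alpha_nat compA.
by rewrite -(compA (f ⊗₁ _)) -tensm_comp compm1.
Qed.
End Bifunctor.

Definition free_amodule (C : symmetric_monoidal_category) (A : comm_algebra C)
  (X : C) : amodule A.
Proof.
exists ((A : C) ⊗ X) (alphaV (A : C) (A : C) X ;; (alg_mul A ⊗₁ idm X)).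
- rewrite -{1}tensm_id -compA alphaV_nat !compA -tensm_mul1 (cm_mulA (alg_laws A)) !tensm_mul1.
  rewrite tensm_1mul !compA -(compA (idm _ ⊗₁ (alg_mul A ⊗₁ _)) (alphaV _ _ _)).
  rewrite alphaV_nat -!compA; do 2 congr (_ ;; _).
  by rewrite pentagonV compA.
- rewrite -{1}tensm_id -compA alphaV_nat compA -tensm_mul1 (cm_unitl (alg_laws A)) -alpha_lam.
  by rewrite -compA alphaVK comp1m.
Defined.

(* The commutative algebra [A ⊕ M], with [M] as a square-zero ideal. *)
Section SquareZero.
Context {C : additive_smc} (P : finite_coproducts C) (A : comm_algebra C).
Context (M : amodule A).
Local Notation AM := (cop P (A : C) (M : C)).
Local Notation p1 := (proj1 P (A : C) (M : C)).
Local Notation p2 := (proj2 P (A : C) (M : C)).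

Definition sqz_mul : hom (AM ⊗ AM) AM :=
  pair P ((p1 ⊗₁ p1) ;; alg_mul A)
         (((p1 ⊗₁ p2) ;; act M) + (sym AM AM ;; (p1 ⊗₁ p2) ;; act M)).

Definition sqz_unit : hom unit_obj AM :=
  pair P (alg_unit A) (hzero unit_obj (M : C)).

Let ract : hom ((M : C) ⊗ (A : C)) M := sym (M : C) (A : C) ;; act M.

Let mulp1 : sqz_mul ;; p1 = (p1 ⊗₁ p1) ;; alg_mul A.
Proof. exact: pair_proj1. Qed.

Let mulp2 : sqz_mul ;; p2 = ((p1 ⊗₁ p2) ;; act M) + ((p2 ⊗₁ p1) ;; ract).
Proof. by rewrite pair_proj2 /ract -[in RHS]compA sym_nat compA. Qed.

Let ract_l : (act M ⊗₁ idm (A : C)) ;; ract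
  = alpha _ _ _ ;; (idm (A : C) ⊗₁ ract) ;; act M.
Proof.
rewrite /ract -compA sym_nat compA tensm_1mul.
have -> : (idm (A : C) ⊗₁ act M) ;; act M
    = alphaV _ _ _ ;; (alg_mul A ⊗₁ idm (M : C)) ;; act M.
  by rewrite act_mul -compA alphaVK comp1m.
rewrite -compA sym_alpha !compA -(compA (sym A A ⊗₁ _)) -tensm_mul1 (cm_mulC (alg_laws A)).
by rewrite act_mul -(compA (alphaV _ _ _)) alphaVK comp1m.
Qed.

Let ract_r : (ract ⊗₁ idm (A : C)) ;; ract
  = alpha _ _ _ ;; (idm (M : C) ⊗₁ alg_mul A) ;; ract.
Proof.
rewrite {1}/ract tensm_mul1 compA ract_l /ract tensm_1mul !compA.
rewrite -(compA (idm _ ⊗₁ alg_mul A)) sym_nat compA act_mul -!compA.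
by congr (_ ;; _); congr (_ ;; _); rewrite (compA (alpha M A A)) hexagon !compA.
Qed.

Lemma sqz_mulC : sym AM AM ;; sqz_mul = sqz_mul.
Proof.
apply: pair_ext; rewrite compA.
  by rewrite mulp1 -compA -sym_nat compA (cm_mulC (alg_laws A)).
rewrite mulp2 compDr haddC -!compA -!sym_nat !compA /ract.
by rewrite -(compA (sym (A : C) M)) symK comp1m.
Qed.

Lemma sqz_unitl : (sqz_unit ⊗₁ idm AM) ;; sqz_mul = lam AM.
Proof.
have u1 : sqz_unit ;; p1 = alg_unit A by exact: pair_proj1.
have u2 : sqz_unit ;; p2 = hzero unit_obj (M : C) by exact: pair_proj2.
apply: pair_ext; rewrite compA.
  rewrite mulp1 -compA -tensm_comp u1 comp1m -lam_nat -(cm_unitl (alg_laws A)) -compA.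
  by rewrite -tensm_comp comp1m compm1.
rewrite mulp2 compDr -!compA -!tensm_comp u1 u2 !compA tens0m comp0m haddm0 comp1m.
by rewrite -lam_nat -act_unit -compA -tensm_comp comp1m compm1.
Qed.

Lemma sqz_unitr : (idm AM ⊗₁ sqz_unit) ;; sqz_mul = rho AM.
Proof. by rewrite -sqz_mulC -compA sym_nat compA sqz_unitl sym_lam. Qed.

Lemma sqz_mulA : (sqz_mul ⊗₁ idm AM) ;; sqz_mul
  = alpha _ _ _ ;; (idm AM ⊗₁ sqz_mul) ;; sqz_mul.
Proof.
apply: pair_ext; rewrite !compA.
  rewrite mulp1 -!(compA (sqz_mul ⊗₁ _)) -!(compA (_ ⊗₁ sqz_mul)) -!tensm_comp.
  by rewrite mulp1 !comp1m; apply: assoc_step; apply: (cm_mulA (alg_laws A)).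
rewrite mulp2 !compDr -!(compA (sqz_mul ⊗₁ _)) -!(compA (_ ⊗₁ sqz_mul)).
rewrite -!tensm_comp mulp1 mulp2 !comp1m tensmDl tensmDr !compDl !compDr.
rewrite (assoc_step _ _ _ (act_mul M)) (assoc_step _ _ _ ract_l).
by rewrite (assoc_step _ _ _ ract_r) haddA.
Qed.
Definition sqz_algebra : comm_algebra C :=
  CommAlgebra (IsCommMonoid sqz_mulA sqz_unitl sqz_unitr sqz_mulC).
End SquareZero.


Record is_algebra_modality (C : symmetric_monoidal_category) (T : monad C)
    (m : forall X : C, hom (T X ⊗ T X) (T X))
    (e : forall X : C, hom unit_obj (T X)) : Prop := IsAlgebraModality {
  am_alg : forall X : C, is_comm_monoid (m X) (e X);
  am_fmap : forall (X Y : C) (f : hom X Y),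
    is_monoid_hom (m X) (e X) (m Y) (e Y) (fmap T f);
  am_mu : forall X : C,
    is_monoid_hom (m (T X)) (e (T X)) (m X) (e X) (mu T X) }.

Record is_deriving_transform (C : additive_smc) (T : monad C)
    (m : forall X : C, hom (T X ⊗ T X) (T X))
    (e : forall X : C, hom unit_obj (T X))
    (d : forall X : C, hom (T X) (T X ⊗ X)) : Prop := IsDerivingTransform {
  dt_nat : forall (X Y : C) (f : hom X Y),
    fmap T f ;; d Y = d X ;; (fmap T f ⊗₁ f);
  dt_unit : forall X : C, e X ;; d X = hzero unit_obj (T X ⊗ X);
  (* [sym] is the symmetry exchanging the blocks [T X ⊗ X] and [T X]. *)
  dt_mul : forall X : C,
    m X ;; d X
    = ((idm (T X) ⊗₁ d X) ;; alphaV (T X) (T X) X ;; (m X ⊗₁ idm X))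
    + ((d X ⊗₁ idm (T X)) ;; sym (T X ⊗ X) (T X) ;; alphaV (T X) (T X) X ;;
       (m X ⊗₁ idm X));
  dt_eta : forall X : C, eta T X ;; d X = lamV X ;; (e X ⊗₁ idm X);
  dt_mu : forall X : C,
    mu T X ;; d X
    = d (T X) ;; (mu T X ⊗₁ d X) ;; alphaV (T X) (T X) X ;; (m X ⊗₁ idm X) }.

Arguments is_algebra_modality {C} T m e.
Arguments is_deriving_transform {C} T m e d.

Definition is_codifferential_category (C : additive_smc) (T : monad C)
    (m : forall X : C, hom (T X ⊗ T X) (T X))
    (e : forall X : C, hom unit_obj (T X))
    (d : forall X : C, hom (T X) (T X ⊗ X)) : Prop :=
  is_algebra_modality T m e /\ is_deriving_transform T m e d.

Arguments is_codifferential_category {C} T m e d.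

Definition is_universal_derivation (C : additive_smc) (P : finite_coproducts C)
    (F : functor C (alg_cat C)) (adj : adjunction F (forget C)) (X : C)
    (d : hom (F X : C) ((F X : C) ⊗ X)) : Prop :=
  let A : comm_algebra C := F X in
  let M : amodule A := free_amodule A X in
  let S : monad C := adj_monad adj in
  let u : hom X (M : C) := lamV X ;; (alg_unit A ⊗₁ idm X) in
  @is_derivation C A M d /\
  unique (fun f : hom (A : C) (sqz_algebra P M : C) =>
            is_alg_hom A (sqz_algebra P M) f /\
            eta S X ;; f = pair P (eta S X) u)
         (pair P (idm (A : C)) d).

Arguments is_universal_derivation {C} P {F} adj X d.

(* Main.v *)
From mathcomp Require Import ssreflect.
Require Import Defs.

Set Implicit Arguments.
Unset Strict Implicit.
Unset Printing Implicit Defensive.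

Local Open Scope cat_scope.

(** A derivation [D] along an algebra map [g : A -> B] is the same thing as an
    algebra map [pair g D] into the square-zero extension of [B].  When [A] is
    free on [X], algebra maps out of [A], hence also derivations along [g], are
    determined by their composite with the unit [X -> A].  The universal
    derivation is therefore obtained by freely extending [pair eta u]; for
    naturality and the chain rule, both sides are derivations along the same
    algebra map ([fmap S f], resp. [mu]), and one compares them on generators. *)

Section FreeAlgebra.
Context {C : symmetric_monoidal_category} {F : functor C (alg_cat C)}.
Variable adj : adjunction F (forget C).

Lemma free_alg_extend (X : C) (B : comm_algebra C) (g : hom X (B : C)) :
  exists f : hom (F X : C) (B : C),
    is_alg_hom (F X) B f /\ adj_unit adj X ;; f = g.
Proof.
exists (fmap (forget C) (fmap F g ;; adj_counit adj B)).
split; first exact: proj2_sig (fmap F g ;; adj_counit adj B).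
by rewrite fmap_comp -compA -adj_unit_nat compA (adj_triangle_r adj B) compm1.
Qed.

Lemma free_alg_hom_ext (X : C) (B : comm_algebra C)
    (f g : hom (F X : C) (B : C)) :
  is_alg_hom (F X) B f -> is_alg_hom (F X) B g ->
  adj_unit adj X ;; f = adj_unit adj X ;; g -> f = g.
Proof.
(* Naturality of the counit and a triangle identity recover an algebra map from its restriction to
   generators. *)
have transpose (h : hom (F X) (B : alg_cat C)) :
    h = fmap F (adj_unit adj X ;; fmap (forget C) h) ;; adj_counit adj B.
  by rewrite fmap_comp compA adj_counit_nat -compA adj_triangle_l comp1m.
move=> hf hg e.
pose f' : hom (F X) (B : alg_cat C) := exist _ f hf.
pose g' : hom (F X) (B : alg_cat C) := exist _ g hg.
suff : f' = g' by move/(f_equal (fmap (forget C))).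
by rewrite (transpose f') (transpose g') /= e.
Qed.

End FreeAlgebra.

Section SquareZeroHom.
Context {C : additive_smc} (P : finite_coproducts C).

Lemma comp_pair (X Y A B : C) (h : hom Y X) (f : hom X A) (g : hom X B) :
  h ;; pair P f g = pair P (h ;; f) (h ;; g).
Proof. by rewrite /pair compDr !compA. Qed.

Lemma sqz_proj1_hom (A : comm_algebra C) (M : amodule A) :
  is_alg_hom (sqz_algebra P M) A (proj1 P (A : C) (M : C)).
Proof. by split; rewrite /= pair_proj1. Qed.

(** These are derivations into [M] with scalars restricted along [g], without building the
    restricted module. At [g = idm A] the formula unfolds to [is_derivation], so the two are
    interchanged silently below. *)
Definition is_derivation_along (A B : comm_algebra C) (M : amodule B)
    (g : hom (A : C) (B : C)) (D : hom (A : C) (M : C)) : Prop :=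
  alg_mul A ;; D
  = (sym A A ;; (g ⊗₁ D) ;; act M) + ((g ⊗₁ D) ;; act M)
  /\ alg_unit A ;; D = hzero unit_obj (M : C).

Lemma pair_alg_homP (A B : comm_algebra C) (M : amodule B)
    (g : hom (A : C) (B : C)) (D : hom (A : C) (M : C)) :
  is_alg_hom A (sqz_algebra P M) (pair P g D) <->
  is_alg_hom A B g /\ is_derivation_along g D.
Proof.
(* The second component of the square-zero product is the right side of the Leibniz rule; both
   implications use this. *)
have mulp2 : (pair P g D ⊗₁ pair P g D) ;; alg_mul (sqz_algebra P M) ;;
      proj2 P (B : C) (M : C)
    = (sym A A ;; (g ⊗₁ D) ;; act M) + ((g ⊗₁ D) ;; act M).
  rewrite /= pair_proj2 compDr -!compA sym_nat (compA (sym A A)).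
  by rewrite -!tensm_comp !pair_proj1 !pair_proj2 compA haddC.
split=> [h|[[gM g1] [DM D1]]].
  split.
    by rewrite -(pair_proj1 P g D); apply: alg_hom_comp h (sqz_proj1_hom M).
  case: h => hM h1; split.
    by rewrite -mulp2 -compA hM compA pair_proj2.
  by rewrite -(pair_proj2 P g D) -compA h1 pair_proj2.
split; last by rewrite comp_pair g1 D1.
apply: pair_ext; rewrite !compA.
  by rewrite /= !pair_proj1 -compA -tensm_comp !pair_proj1 gM.
by rewrite mulp2 pair_proj2 DM.
Qed.

(** The assumption on [k] is linearity over [g], which carries each term of the Leibniz rule for [D]
    across. *)
Lemma derivation_along_comp (A B : comm_algebra C) (M : amodule A)
    (N : amodule B) (g : hom (A : C) (B : C)) (D : hom (A : C) (M : C))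
    (k : hom (M : C) (N : C)) :
  act M ;; k = (g ⊗₁ k) ;; act N ->
  is_derivation D -> is_derivation_along g (D ;; k).
Proof.
move=> kM [DM D1]; split; last by rewrite -compA D1 comp0m.
by rewrite -compA DM compDl !compA kM -!(compA (_ ⊗₁ D)) -tensm_comp comp1m.
Qed.

Lemma free_derivation_ext (F : functor C (alg_cat C))
    (adj : adjunction F (forget C)) (X : C) (B : comm_algebra C)
    (M : amodule B) (g : hom (F X : C) (B : C)) (D E : hom (F X : C) (M : C)) :
  is_alg_hom (F X) B g ->
  is_derivation_along g D -> is_derivation_along g E ->
  adj_unit adj X ;; D = adj_unit adj X ;; E -> D = E.
Proof.
move=> hg hD hE e; rewrite -(pair_proj2 P g D) -(pair_proj2 P g E).
congr (_ ;; _); apply: (free_alg_hom_ext (adj := adj) (B := sqz_algebra P M)).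
- exact/pair_alg_homP.
- exact/pair_alg_homP.
- by rewrite !comp_pair e.
Qed.

(** [pair P g (g ;; D)] is [g] followed by the algebra map [pair P (idm B) D], which spares a
    Leibniz computation. *)
Lemma derivation_along_precomp (A B : comm_algebra C) (M : amodule B)
    (g : hom (A : C) (B : C)) (D : hom (B : C) (M : C)) :
  is_alg_hom A B g -> is_derivation D -> is_derivation_along g (g ;; D).
Proof.
move=> hg hD; have hid := alg_hom_id B.
suff /pair_alg_homP[] : is_alg_hom A (sqz_algebra P M) (pair P g (g ;; D)) by [].
rewrite -{1}[g]compm1 -comp_pair; apply: alg_hom_comp hg _.
exact/pair_alg_homP.
Qed.

End SquareZeroHom.

Section FreeModule.
Context {C : symmetric_monoidal_category}.

Lemma comp_lamV (X Y : C) (f : hom X Y) :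
  f ;; lamV Y = lamV X ;; (idm unit_obj ⊗₁ f).
Proof.
rewrite -[RHS]compm1 -(lamK Y) -!compA (compA (lamV X)) lam_nat -!compA.
by rewrite lamVK comp1m.
Qed.

Lemma act_free_tensm (A B : comm_algebra C) (X Y : C)
    (g : hom (A : C) (B : C)) (f : hom X Y) :
  is_alg_hom A B g ->
  act (free_amodule A X) ;; (g ⊗₁ f)
  = (g ⊗₁ (g ⊗₁ f)) ;; act (free_amodule B Y).
Proof.
move=> [gM _]; rewrite /= -compA alphaV_nat !compA -!tensm_comp gM.
by rewrite comp1m compm1.
Qed.

(** Here [(g ⊗₁ h) ;; act N] extends [h] to a [g]-linear map out of the free module on [X]. The
    chain rule takes [g] to be [mu] and [h] to be [d X]. *)
Lemma act_free_extend (A B : comm_algebra C) (N : amodule B) (X : C)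
    (g : hom (A : C) (B : C)) (h : hom X (N : C)) :
  is_alg_hom A B g ->
  act (free_amodule A X) ;; (g ⊗₁ h) ;; act N
  = (g ⊗₁ ((g ⊗₁ h) ;; act N)) ;; act N.
Proof.
(* [g ⊗₁ h] is [g]-linear into the free [B]-module on [N], and [act N] is [B]-linear by
   associativity of the action. *)
move=> hg; rewrite -compA (act_free_tensm h hg) /= !compA act_mul.
rewrite -(compA (alphaV _ _ _)) alphaVK comp1m.
by rewrite -compA -tensm_comp compm1.
Qed.

(** The extension restricts to [h] on generators because [g] preserves the unit, which acts
    trivially. *)
Lemma unit_free_extend (A B : comm_algebra C) (N : amodule B) (X : C)
    (g : hom (A : C) (B : C)) (h : hom X (N : C)) :
  is_alg_hom A B g ->
  (lamV X ;; (alg_unit A ⊗₁ idm X)) ;; (g ⊗₁ h) ;; act N = h.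
Proof.
move=> [_ g1].
rewrite !compA -(compA (alg_unit A ⊗₁ _)) -tensm_comp g1 comp1m.
rewrite -[alg_unit B]comp1m -[h in LHS]compm1 tensm_comp compA act_unit.
by rewrite -compA -comp_lamV compA lamVK compm1.
Qed.

End FreeModule.

Section UniversalDerivation.
Context {C : additive_smc} (P : finite_coproducts C).
Context {F : functor C (alg_cat C)} (adj : adjunction F (forget C)).

Lemma universal_derivation_exists_unique (X : C) :
  exists! d, is_universal_derivation P adj X d.
Proof.
set M := free_amodule (F X : comm_algebra C) X.
set u := lamV X ;; (alg_unit (F X : comm_algebra C) ⊗₁ idm X).
have [f [hf ef]] :=
  free_alg_extend adj (B := sqz_algebra P M) (pair P (adj_unit adj X) u).
(* The first component is an algebra endomorphism fixing the generators. *)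
have f1 : f ;; proj1 P _ _ = idm _.
  apply: (free_alg_hom_ext (adj := adj) (B := F X)).
  - exact: alg_hom_comp hf (sqz_proj1_hom P M).
  - exact: alg_hom_id.
  - by rewrite -compA ef pair_proj1 compm1.
have fE : pair P (idm _) (f ;; proj2 P _ _) = f by rewrite -f1 -pair_eta.
have [_ hD] := iffLR (pair_alg_homP P _ _) (eq_ind_r (is_alg_hom _ _) hf fE).
exists (f ;; proj2 P _ _); split.
  split; first exact: hD.
  split; first by rewrite fE; split.
  move=> f' [hf' ef']; rewrite fE.
  by apply: (free_alg_hom_ext (adj := adj) hf hf'); rewrite ef.
(* Any universal [d] gives an algebra map [pair P (idm _) d] that agrees with [f] on generators. *)
move=> d [_ [[hd ed] _]].
by rewrite -(free_alg_hom_ext (adj := adj) hd hf _) ?pair_proj2 ?ef.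
Qed.

Lemma universal_derivation_eta (X : C) d : is_universal_derivation P adj X d ->
  adj_unit adj X ;; d = lamV X ;; (alg_unit (F X : comm_algebra C) ⊗₁ idm X).
Proof.
by case=> _ [[_ e] _]; rewrite -(pair_proj2 P (idm _) d) -compA e pair_proj2.
Qed.

Lemma free_alg_modality :
  is_algebra_modality (adj_monad adj)
    (fun X => alg_mul (F X : comm_algebra C))
    (fun X => alg_unit (F X : comm_algebra C)).
Proof.
split=> X; first exact: alg_laws.
  by move=> Y f; apply: proj2_sig (fmap F f).
exact: proj2_sig (adj_counit adj (F X)).
Qed.

Lemma universal_deriving_transform
    (d : forall X : C, hom (adj_monad adj X) (adj_monad adj X ⊗ X)) :
  (forall X, is_universal_derivation P adj X (d X)) ->
  is_deriving_transform (adj_monad adj)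
    (fun X => alg_mul (F X : comm_algebra C))
    (fun X => alg_unit (F X : comm_algebra C)) d.
Proof.
move=> hd.
have der X : @is_derivation C (F X) (free_amodule (F X : comm_algebra C) X) (d X).
  by case: (hd X).
have eta_d X := universal_derivation_eta (hd X).
split=> [X Y f|X|X|X|X].
- have hf := am_fmap free_alg_modality f.
  apply: (free_derivation_ext P (adj := adj) hf
            (M := free_amodule (F Y : comm_algebra C) Y)).
  + exact: (derivation_along_precomp P hf (der Y)).
  + apply: (derivation_along_comp _ (der X)).
    exact: (act_free_tensm f hf).
  (* On generators both sides become [lamV X ;; (alg_unit (F Y) ⊗₁ f)]. *)
  + rewrite -!compA -(eta_nat (adj_monad adj) f) eta_d !compA eta_d -!compA.
    rewrite comp_lamV !compA -!tensm_comp; case: hf => _ ->.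
    by rewrite !comp1m compm1.
- by case: (der X).
(* The Leibniz rule lists its summands in the other order and applies the symmetry before [d]. *)
- by have [-> _] := der X; rewrite haddC -!compA sym_nat.
- exact: eta_d.
- have hmu := am_mu free_alg_modality X.
  apply: (free_derivation_ext P (adj := adj) hmu
            (M := free_amodule (F X : comm_algebra C) X)).
  + exact: (derivation_along_precomp P hmu (der X)).
  + apply: (derivation_along_comp _ (der (adj_monad adj X))).
    exact: (act_free_extend (N := free_amodule (F X : comm_algebra C) X) _ hmu).
  (* On generators both sides become [d X]: the left by the monad unit law, the right by
     [unit_free_extend]. *)
  + rewrite -!(compA (adj_unit adj _)) (mu_eta_l (adj_monad adj) X) comp1m eta_d.
    by rewrite (unit_free_extend (N := free_amodule (F X : comm_algebra C) X) _ hmu).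
Qed.

End UniversalDerivation.

Theorem theorem3p4
  (C : additive_smc) (P : finite_coproducts C)
  (coeqC : has_reflexive_coequalizers C)
  (tens_coeqC : tensor_preserves_reflexive_coequalizers C)
  (F : functor C (alg_cat C)) (adj : adjunction F (forget C)) :
  let S : monad C := adj_monad adj in
  let alg (X : C) : comm_algebra C := F X in
  (forall X : C,
     exists! d : hom (S X) (tens (S X) X), is_universal_derivation P adj X d) /\
  (forall d : forall X : C, hom (S X) (tens (S X) X),
     (forall X : C, is_universal_derivation P adj X (d X)) ->
     is_codifferential_category S
       (fun X : C => alg_mul (alg X)) (fun X : C => alg_unit (alg X)) d).
Proof.
split; first exact: universal_derivation_exists_unique.
move=> d hd; split; first exact: free_alg_modality.
exact: universal_deriving_transform hd.
Qed.
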